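(* Let $X$ be a homogeneously self-similar graph with constant inner degree $b$. Then the following conditions are equivalent: (i) $X$ has bounded geometry. (ii) $b=\theta_X-1$. (iii) $X$ is locally finite and $\deg_X v=\deg_{X_F}v$ for all $v\in F$. (iv) $\delta_X=|\delta C_n|$ for any $n$-cell $C_n$ (for every positive integer $n$). (v) For any vertex $v$ in the boundary of any $n$-cell $C_n$ ($n$ any positive integer) there is exactly one cell $C$ contained in $C_n$ such that $v\in\theta C$. (vi) $\delta_X=\theta_X(\theta_X-1)$.
   Context: Graph $X$ with vertex set $VX$ and edge set $EX$ is connected, locally finite, infinite, without loops or multiple edges. $d_X$ is the graph distance and $\deg_X x$ the number of neighbours of $x$ in $X$. For $C\subset VX$, the boundary $\theta C$ is the set of vertices in $VX\setminus C$ adjacent to some vertex of $C$; the closure is $\overline{C}=C\cup\theta C$; $\hat C$ is the subgraph of $X$ spanned (induced) by $\overline{C}$; the edge boundary $\delta C$ is the set of edges connecting a vertex in $C$ with a vertex in $VX\setminus C$. For $F\subset VX$, $\mathcal{C}_XF$ denotes the set of connected components of $VX\setminus F$ (as vertex sets). The reduced graph $X_F$ has vertex set $F$, and two (distinct) vertices $x,y\in F$ are adjacent in $X_F$ iff there is $C\in\mathcal{C}_XF$ with $x,y\in\theta C$. $X$ is self-similar with respect to $F\subset VX$ and $\psi:VX\to F$ if: (F1) no two vertices of $F$ are adjacent in $X$; (F2) the intersection of the closures of two different components in $\mathcal{C}_XF$ contains at most one vertex; (F3) $\psi$ is a graph isomorphism from $X$ to $X_F$. Put $F^0=VX$, $F^n=\psi^n(VX)$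 (so $F^1=F$). Elements of $\mathcal{C}_XF^n$ are called $n$-cells; $1$-cells are called cells. A self-similar graph $X$ is homogeneously self-similar if: (H1) all cell graphs $\hat C$ ($C\in\mathcal{C}_XF$) are finite and for any cells $C,D$ there is a graph isomorphism $\alpha:\hat C\to\hat D$ with $\alpha(\theta C)=\theta D$; (H2) for every cell $C$ and $v_1,v_2,v_3,v_4\in\theta C$ with $v_1\neq v_2$, $v_3\ne v_4$, one has $d_X(v_1,v_2)=d_X(v_3,v_4)$. Put $\theta_X=|\theta C|$ and $\delta_X=|\delta C|$ for a cell $C$ (independent of the choice of $C$). $X$ has bounded geometry if the set of its vertex degrees is bounded. A number $b$ is a constant inner degree of $X$ if $b=\deg_{\hat C}v$ for every cell $C$ and every $v\in\theta C$. *)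

(* Defs.v *)
(* MathComp world, with the sets and cardinalities of mathcomp.classical. *)
From mathcomp Require Import all_boot all_order finmap.
From mathcomp Require Import boolp classical_sets functions cardinality.

Set Implicit Arguments.
Unset Strict Implicit.
Unset Printing Implicit Defensive.

Local Open Scope classical_set_scope.

Definition num_elements (T : choiceType) (A : set T) : nat := #|` fset_set A|%fset.

(* A simple graph whose vertex set is all of [V]. Graphs on a subset [A] of
   [V], such as spanned subgraphs and reduced graphs, are given by the set [A]
   and an adjacency relation on [V] that only relates elements of [A]. *)
Record sgraph (V : choiceType) := SGraph {
  adj :> rel V;
  adj_sym : symmetric adj;
  adj_irr : irreflexive adj
}.

Definition neighbours (V : choiceType) (e : rel V) (v : V) : set V :=
  [set w | e v w].

(* The value is meaningful where [neighbours e v] is finite; [fset_set] sends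
   infinite sets to the empty one. *)
Definition degree (V : choiceType) (e : rel V) (v : V) : nat :=
  num_elements (neighbours e v).

Definition linked (V : choiceType) (e : rel V) (x y : V) : Prop :=
  exists2 p : seq V, path e x p & last x p = y.

Definition graph_iso (V W : choiceType) (A : set V) (e : rel V)
    (B : set W) (e' : rel W) (f : V -> W) : Prop :=
  set_bij A B f /\ (forall x y, A x -> A y -> e' (f x) (f y) = e x y).

Section Graph.
Variables (V : choiceType) (X : sgraph V).
Implicit Types (C F : set V) (psi : V -> V).

Definition connected_graph : Prop := forall x y : V, linked X x y.

Definition locally_finite : Prop := forall v, finite_set (neighbours X v).

Definition infinite_graph : Prop := infinite_set [set: V].

Definition bounded_geometry : Prop := exists M : nat, forall v, degree X v <= M.

Definition is_distance (x y : V) (n : nat) : Prop :=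
  (exists p, [/\ path X x p, last x p = y & size p = n]) /\
  (forall p, path X x p -> last x p = y -> n <= size p).

Definition distance (x y : V) : nat := xget 0 [set n | is_distance x y n].

Definition boundary C : set V :=
  [set v | ~ C v /\ exists2 w, C w & X w v].

Definition graph_closure C : set V := C `|` boundary C.

(* An edge of the edge boundary is recorded as the ordered pair of its endpoint
   in [C] and its endpoint outside [C], so each edge occurs exactly once. *)
Definition edge_boundary C : set (V * V) :=
  [set xy | [/\ C xy.1, ~ C xy.2 & X xy.1 xy.2]].

Definition spanned (A : set V) : rel V :=
  [rel x y | [&& x \in A, y \in A & X x y]].

Definition components F : set (set V) :=
  [set C | exists2 x, ~ F x & C = [set y | linked (spanned (~` F)) x y]].

Definition reduced F : rel V :=
  [rel x y | [&& x \in F, y \in F, x != y &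
     `[< exists2 C, components F C & boundary C x /\ boundary C y >]]].

Record self_similar F psi : Prop := SelfSimilar {
  self_similar_F1 : forall x y, F x -> F y -> ~ X x y;
  self_similar_F2 : forall C D, components F C -> components F D -> C <> D ->
    forall x y, (graph_closure C `&` graph_closure D) x ->
                (graph_closure C `&` graph_closure D) y -> x = y;
  self_similar_F3 : graph_iso [set: V] X F (reduced F) psi
}.

Definition Fpow psi (n : nat) : set V := iter n psi @` [set: V].

Definition ncells psi (n : nat) : set (set V) := components (Fpow psi n).

Record homogeneously_self_similar F psi : Prop := HomogeneouslySelfSimilar {
  homogeneous_self_similar : self_similar F psi;
  homogeneous_finite : forall C, components F C -> finite_set (graph_closure C);
  homogeneous_iso : forall C D, components F C -> components F D ->
    exists2 alpha : V -> V,
      graph_iso (graph_closure C) (spanned (graph_closure C))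
                (graph_closure D) (spanned (graph_closure D)) alpha &
      alpha @` boundary C = boundary D;
  homogeneous_distance : forall C, components F C -> forall v1 v2 v3 v4,
    boundary C v1 -> boundary C v2 -> boundary C v3 -> boundary C v4 ->
    v1 <> v2 -> v3 <> v4 -> distance v1 v2 = distance v3 v4
}.

(* In a homogeneously self-similar graph the next two numbers do not depend on
   the cell that [xget] chooses. *)
Definition theta_number F : nat :=
  num_elements (boundary (xget set0 (components F))).

Definition delta_number F : nat :=
  num_elements (edge_boundary (xget set0 (components F))).

Definition constant_inner_degree F (b : nat) : Prop :=
  forall C, components F C -> forall v, boundary C v ->
    b = degree (spanned (graph_closure C)) v.

End Graph.

(* Main.v *)
Require Import Defs.
From mathcomp Require Import all_boot all_order finmap.
From mathcomp Require Import boolp classical_sets functions cardinality.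

Set Implicit Arguments.
Unset Strict Implicit.
Unset Printing Implicit Defensive.

Local Open Scope classical_set_scope.

(* Let theta be the number of boundary vertices of a cell and n(v) the number of
   cells that have v in their boundary. For v in F, the neighbours of v are
   shared out among these cells, b in each, so deg_X v = b n(v). By (F2) the
   neighbours of v in X_F are also shared out, theta - 1 to each cell, so
   deg_{X_F} v = (theta - 1) n(v). As psi is an isomorphism onto X_F,
     (theta - 1) deg_X (psi v) = b deg_X v.
   Hence along the orbit of psi the degrees are constant if b = theta - 1 and
   strictly monotone otherwise, where a strict decrease is impossible. If they
   are constant then X has bounded geometry: psi at least doubles distances, so
   all vertices but at most one have the form psi^n w with w in a cell.
   The psi-preimage of an (n+1)-cell C is an n-cell D whose boundary is mapped
   onto that of C. The same count inside C relates the number m of cells of C at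
   psi v to the number of neighbours of v in D, which is (theta - 1) m. So m = 1
   for all n if b = theta - 1, and the case n = 1 gives the converse. *)

(** * Cardinalities of finite sets and double counting *)

Section NumElements.
Variables T U : choiceType.
Implicit Types (A : set T) (B : set U).

Lemma num_elements_gt0 A : finite_set A -> A !=set0 -> 0 < num_elements A.
Proof.
move=> fA [a Aa]; rewrite /num_elements cardfs_gt0; apply/fset0Pn; exists a.
by rewrite in_fset_set// inE.
Qed.

Lemma num_elements1 (a : T) : num_elements [set a] = 1.
Proof. by rewrite /num_elements fset_set1 cardfs1. Qed.

Lemma num_elements_eq1 A : finite_set A -> num_elements A = 1 ->
  exists a, A = [set a].
Proof.
move=> fA /eqP/cardfs1P[a Aa]; exists a.
by rewrite -(fset_setK fA) Aa; apply/seteqP; split=> x /=; rewrite inE => /eqP.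
Qed.

Lemma le_num_elements A A' : finite_set A' -> A `<=` A' ->
  num_elements A <= num_elements A'.
Proof.
move=> fA' AA'; apply: fsubset_leq_card.
by rewrite -fset_set_sub //; apply: sub_finite_set fA'.
Qed.

Lemma num_elements_other A v : finite_set A ->
  1 < num_elements A -> exists2 u, A u & v <> u.
Proof.
move=> fA A1; apply: contrapT => nA; move: A1; rewrite ltnNge => /negP; apply.
rewrite -(num_elements1 v); apply: le_num_elements; first exact: finite_set1.
by move=> u Au; apply: contrapT => uv; apply: nA; exists u => // vu; apply: uv.
Qed.

Lemma num_elements_setD1 A a : finite_set A -> A a ->
  num_elements (A `\ a) = num_elements A - 1.
Proof.
move=> fA Aa; rewrite /num_elements fset_setD1//.
by rewrite (cardfsD1 a (fset_set A)) in_fset_set// mem_set// addKn.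
Qed.

Lemma num_elements_image (f : T -> U) A : finite_set A -> set_inj A f ->
  num_elements (f @` A) = num_elements A.
Proof.
move=> fA finj; rewrite /num_elements fset_set_image// card_in_imfset//= => x y.
by rewrite !in_fset_set//; apply: finj.
Qed.

Lemma num_elements_sum B (P : U -> Prop) : finite_set B ->
  num_elements [set c | B c /\ P c] = \sum_(c <- fset_set B) `[< P c >].
Proof.
move=> fB; rewrite /num_elements; set D := [set c | _].
have -> : fset_set D = [fset c in fset_set B | `[< P c >]]%fset.
  apply/fsetP => c; rewrite in_fset_set; last by apply: sub_finite_set fB => ? [].
  rewrite !inE/= in_fset_set//; apply/idP/andP; rewrite !inE//.
by rewrite card_fset_sum1 big_fset/= big_mkcond; apply: eq_bigr => c _; case: ifP.
Qed.

End NumElements.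

Lemma double_counting (T U : choiceType) (A : set T) (B : set U)
    (R : T -> U -> Prop) j k :
  finite_set A -> finite_set B ->
  (forall a, A a -> num_elements [set c | B c /\ R a c] = j) ->
  (forall c, B c -> num_elements [set a | A a /\ R a c] = k) ->
  num_elements A * j = num_elements B * k.
Proof.
move=> fA fB Aj Bk.
transitivity (\sum_(a <- fset_set A) \sum_(c <- fset_set B) `[< R a c >]).
  rewrite /num_elements card_fset_sum1 big_distrl/=; apply: eq_big_seq => a.
  by rewrite in_fset_set// inE mul1n => /Aj <-; rewrite num_elements_sum.
rewrite exchange_big /num_elements card_fset_sum1 big_distrl/=.
apply: eq_big_seq => c; rewrite in_fset_set// inE mul1n => /Bk <-.
by rewrite (num_elements_sum (fun a => R a c)).
Qed.

(** The form of double counting used below: neighbours are counted by the cell that contains them,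
    neighbours in the reduced graph by the cell that they share with the vertex, boundary edges by
    their outer endpoint. *)
Lemma unique_counting (T U : choiceType) (A : set T) (B : set U)
    (R : T -> U -> Prop) k :
  finite_set A -> finite_set B ->
  (forall a, A a -> exists! c, B c /\ R a c) ->
  (forall c, B c -> num_elements [set a | A a /\ R a c] = k) ->
  num_elements A = num_elements B * k.
Proof.
move=> fA fB Au Bk; rewrite -(double_counting fA fB _ Bk (j := 1)) ?muln1//.
move=> a /Au[c [Bc cu]]; rewrite -(num_elements1 c); congr num_elements.
by apply/seteqP; split=> d /=; [move/cu->|move->].
Qed.

(** Finiteness of [A] excludes the default value 0 that [num_elements] takes on infinite sets. *)
Lemma card_eq_num_elements (T : choiceType) (A : set T) n :
  finite_set A -> (A #= `I_n)%card <-> num_elements A = n.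
Proof.
move=> fA; rewrite -[X in (X #= _)%card]fset_setK//.
by split=> /card_eq_fsetP.
Qed.

(** * Connection by paths *)

Section Linked.
Variables (V : choiceType) (e : rel V).

Lemma linked_refl x : linked e x x.
Proof. by exists [::]. Qed.

Lemma linked_trans y x z : linked e x y -> linked e y z -> linked e x z.
Proof.
move=> [p px <-] [q qy <-]; exists (p ++ q); last by rewrite last_cat.
by rewrite cat_path px.
Qed.

Lemma linked_adj x y : e x y -> linked e x y.
Proof. by move=> xy; exists [:: y] => //=; rewrite xy. Qed.

Lemma linked_sym : symmetric e -> forall x y, linked e x y -> linked e y x.
Proof.
move=> es x y [p px <-]; exists (rev (belast x p)).
  by rewrite rev_path (eq_path (e' := e)).
by case: p px => //= a p _; rewrite rev_cons last_rcons.
Qed.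

End Linked.

(** The case [x = y] stands apart because the empty path links [x] to itself even when [x] is
    outside [A]. *)
Lemma linked_spannedP (V : choiceType) (X : sgraph V) (A : set V) x y :
  linked (spanned X A) x y <-> x = y \/ A x /\
  exists p, [/\ path X x p, last x p = y & forall z, z \in p -> A z].
Proof.
split.
  move=> [[|a p] /=]; first by left.
  move=> pa lp; right; split.
    by move: pa => /andP[/and3P[+ _ _] _]; rewrite inE.
  exists (a :: p); split=> //=.
    move: pa => /andP[/and3P[_ _ ->]] /=; apply: sub_path => u v.
    by move=> /and3P[].
  elim: p x a pa {lp} => [|c p IH] x a /=.
    by rewrite andbT => /and3P[_]; rewrite inE => ? _ z; rewrite inE => /eqP ->.
  move=> /andP[/and3P[_ aA _] cp] z; rewrite inE => /orP[/eqP->|zp].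
    by move: aA; rewrite inE.
  by apply: IH zp; exact: cp.
case=> [->|]; first exact: linked_refl.
move=> [+ [p [+ + +]]]; elim: p x => [|a p IH] x /=.
  by move=> _ _ <- _; exact: linked_refl.
move=> Ax /andP[xa pa] lp pA; have Aa : A a by apply: pA; rewrite inE eqxx.
apply: (@linked_trans _ _ a); last first.
  by apply: IH => // z zp; apply: pA; rewrite inE zp orbT.
by apply: linked_adj; rewrite /spanned/= !mem_set.
Qed.


Lemma linked_map (V W : choiceType) (e : rel V) (e' : rel W) (f : V -> W) :
  (forall x y, e x y -> linked e' (f x) (f y)) ->
  forall x y, linked e x y -> linked e' (f x) (f y).
Proof.
move=> ee' x y [p + <-]; elim: p x => [|a p IH] x /=.
  by move=> _; exact: linked_refl.
by move=> /andP[/ee' xa /IH]; exact: linked_trans.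
Qed.

(** * Components of the complement of a vertex set *)

Section Components.
Variables (V : choiceType) (X : sgraph V).
Implicit Types (C D F G : set V).

Definition component_of F (x : V) : set V :=
  [set y | linked (spanned X (~` F)) x y].

Lemma spanned_sym (A : set V) : symmetric (spanned X A).
Proof. by move=> x y; rewrite /spanned/= adj_sym andbCA. Qed.

Lemma components_of F x : ~ F x -> components X F (component_of F x).
Proof. by move=> Fx; exists x. Qed.

Lemma component_of_refl F x : component_of F x x.
Proof. exact: linked_refl. Qed.

Lemma components_neq0 F C : components X F C -> C !=set0.
Proof. by move=> [x _ ->]; exists x; exact: component_of_refl. Qed.

Lemma components_notin F C x : components X F C -> C x -> ~ F x.
Proof.
move=> [y Fy ->] /linked_spannedP[<- //|[_ [p [_ <- pF]]]].
by case: p pF => [//|a p] /(_ (last a p)) /=; apply; exact: mem_last.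
Qed.

Lemma componentsE F C x : components X F C -> C x -> C = component_of F x.
Proof.
move=> [y Fy ->] yx; apply/seteqP; split=> z.
  by apply: linked_trans; apply: linked_sym yx; exact: spanned_sym.
exact: linked_trans.
Qed.

Lemma components_eq F C D x :
  components X F C -> components X F D -> C x -> D x -> C = D.
Proof.
by move=> FC FD Cx Dx; rewrite (componentsE FC Cx) (componentsE FD Dx).
Qed.

Lemma components_closed F C x y :
  components X F C -> C x -> X x y -> ~ F y -> C y.
Proof.
move=> FC Cx xy Fy; rewrite (componentsE FC Cx); apply: linked_adj.
by rewrite /spanned/= !mem_set//; exact: components_notin FC Cx.
Qed.

Lemma boundary_components F C v : components X F C -> boundary X C v -> F v.
Proof.
move=> FC [Cv [w Cw wv]]; apply: contrapT => Fv; apply: Cv.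
exact: components_closed FC Cw wv Fv.
Qed.

Lemma components_boundary F C v w :
  components X F C -> F v -> C w -> X w v -> boundary X C v.
Proof. by move=> FC Fv Cw wv; split; [move/(components_notin FC)|exists w]. Qed.

Lemma components_sub F G C D x : G `<=` F ->
  components X F C -> components X G D -> C x -> D x -> C `<=` D.
Proof.
move=> GF FC GD Cx Dx y; rewrite (componentsE FC Cx) (componentsE GD Dx).
apply: (linked_map (f := id)) => u v /and3P[]; rewrite !inE => Fu Fv uv.
by apply: linked_adj; rewrite /spanned/= !mem_set// => /GF.
Qed.

(** The vertex [u] has a neighbour [w] in [C]. Since neither [u] nor [w] is in [G], both lie in the
    same component of the complement of [G], and that component contains all of [C] once it contains
    [w]. *)
Lemma components_subP F G C D u : G `<=` F ->
  components X F C -> components X G D -> boundary X C u -> ~ G u ->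
  D u <-> C `<=` D.
Proof.
move=> GF FC GD [Cu [w Cw wu]] Gu; split=> [Du|/(_ _ Cw) Dw].
  apply: (components_sub GF FC GD Cw); apply: (components_closed GD Du).
    by rewrite adj_sym.
  by move/GF; exact: components_notin FC Cw.
exact: components_closed GD Dw wu Gu.
Qed.

End Components.

(** * Self-similar graphs: contraction of paths and the sets [Fpow psi n] *)

Section SelfSimilar.
Variables (V : choiceType) (X : sgraph V) (F : set V) (psi : V -> V).
Hypothesis Xself_similar : self_similar X F psi.

Let F_independent := self_similar_F1 Xself_similar.

Lemma psi_in x : F (psi x).
Proof.
by have [[fs _ _] _] := self_similar_F3 Xself_similar; exact: (fs x I).
Qed.

Lemma psi_inj : injective psi.
Proof.
have [[_ fi _] _] := self_similar_F3 Xself_similar => x y.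
by apply: fi; exact: in_setT.
Qed.

Lemma psi_surj y : F y -> exists x, psi x = y.
Proof.
have [[_ _ fs] _] := self_similar_F3 Xself_similar.
by move=> /fs[x _ <-]; exists x.
Qed.

Lemma psi_adj x y : reduced X F (psi x) (psi y) = X x y.
Proof. by have [_ ->] := self_similar_F3 Xself_similar. Qed.

Lemma reducedP x y : reduced X F x y <->
  x <> y /\ exists2 C, components X F C & boundary X C x /\ boundary X C y.
Proof.
split=> [/and4P[_ _ /eqP ? /asboolP ?] //|[xy [C FC [Cx Cy]]]].
apply/and4P; split; [| |exact/eqP|by apply/asboolP; exists C].
- by rewrite mem_set//; exact: boundary_components FC Cx.
- by rewrite mem_set//; exact: boundary_components FC Cy.
Qed.

Lemma neighbours_reduced v :
  neighbours (reduced X F) (psi v) = psi @` neighbours X v.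
Proof.
apply/seteqP; split=> [u vu|_ [u vu <-]]; last by rewrite /neighbours/= psi_adj.
have /psi_surj[u' u'E] : F u by have /and4P[_] := vu; rewrite inE.
by exists u' => //; move: vu; rewrite /neighbours/= -u'E psi_adj.
Qed.

Lemma cell_eq C D u v : components X F C -> components X F D -> u <> v ->
  boundary X C u -> boundary X C v -> boundary X D u -> boundary X D v -> C = D.
Proof.
move=> FC FD uv Cu Cv Du Dv; apply: contrapT => CD; apply: uv.
by apply: (self_similar_F2 Xself_similar FC FD CD); split; right.
Qed.

(** Two boundary vertices of one cell are adjacent in the reduced graph, so their preimages under
    [psi] are adjacent in [X] and cannot both lie in the independent set [F]. *)
Lemma not_in_image_boundary (G : set V) C u v : G `<=` F ->
  components X F C -> u <> v -> boundary X C u -> boundary X C v ->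
  (psi @` G) u -> ~ (psi @` G) v.
Proof.
move=> GF FC uv Cu Cv [u' Gu uE] [v' Gv vE].
have : reduced X F u v by apply/reducedP; split=> //; exists C.
by rewrite -uE -vE psi_adj => /F_independent; apply; exact: GF.
Qed.

(** A path of [X] between vertices of [F] is read as its sequence of visits to [F], which is a path
    of the reduced graph and is pulled back by [psi]. The second clause is the state of this reading
    inside a cell [C] entered from [psi x]. By (F1) two visits are at least two steps apart, hence
    the factor 2; the extra 1 in the second clause is the step that entered [C]. *)
Lemma path_contraction p :
  (forall x, path X (psi x) p -> F (last (psi x) p) ->
     exists q, [/\ path X x q, psi (last x q) = last (psi x) p,
                   (size q).*2 <= size p & {subset map psi q <= p}]) /\
  (forall C w x, components X F C -> C w -> boundary X C (psi x) ->
     path X w p -> F (last w p) ->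
     exists q, [/\ path X x q, psi (last x q) = last w p,
                   (size q).*2 <= (size p).+1 & {subset map psi q <= p}]).
Proof.
elim: p => [|a p [IH1 IH2]].
  split=> [x _ _|C w x FC Cw _ _ /(components_notin FC Cw)//].
  by exists [::].
split.
- move=> x /= /andP[xa pa] Fp.
  have Fa : ~ F a by move=> Fa; exact: F_independent (psi_in x) Fa xa.
  have FC := components_of X Fa.
  have Ca : component_of X F a a by exact: component_of_refl.
  have Cx : boundary X (component_of X F a) (psi x).
    by apply: components_boundary FC (psi_in x) Ca _; rewrite adj_sym.
  have [q [xq qp sq qs]] := IH2 _ _ _ FC Ca Cx pa Fp.
  by exists q; split=> // z /qs; rewrite inE orbC => ->.
- move=> C w x FC Cw Cx /= /andP[wa pa] Fp.
  have [Fa|Fa] := pselect (F a); last first.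
    have Ca := components_closed FC Cw wa Fa.
    have [q [xq qp sq qs]] := IH2 _ _ _ FC Ca Cx pa Fp.
    exists q; split=> // [|z /qs]; last by rewrite inE orbC => ->.
    exact: leq_trans sq _.
  have Ca := components_boundary FC Fa Cw wa.
  have [a' aE] := psi_surj Fa; rewrite -aE in pa Fp Ca *.
  have [q [xq qp sq qs]] := IH1 _ pa Fp.
  (* If the path leaves the cell where it entered it, no new vertex is recorded; otherwise [C]
     itself witnesses the edge from [x] to [a']. *)
  have [xa'|xa'] := eqVneq x a'.
    rewrite xa'; exists q; split=> // [|z /qs]; last by rewrite inE orbC => ->.
    by rewrite (leq_trans sq)// -addn2 leq_addr.
  exists (a' :: q); split=> //=.
  + rewrite xq andbT -psi_adj; apply/reducedP; split; last by exists C.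
    by move/psi_inj/eqP; apply/negP.
  + by move=> z; rewrite !inE => /orP[->//|/qs ->]; rewrite orbT.
Qed.

Lemma FpowS n : Fpow psi n.+1 = psi @` Fpow psi n.
Proof. by rewrite /Fpow -image_comp; apply: eq_imagel. Qed.

Lemma Fpow_inF n : Fpow psi n.+1 `<=` F.
Proof. by rewrite FpowS => _ [x _ <-]; exact: psi_in. Qed.

Lemma Fpow1 : Fpow psi 1 = F.
Proof.
apply/seteqP; split; first exact: Fpow_inF.
by move=> x /psi_surj[y <-]; exists y.
Qed.

Lemma Fpow_psi n x : Fpow psi n.+1 (psi x) -> Fpow psi n x.
Proof. by rewrite FpowS => -[y Fy /psi_inj <-]. Qed.

(** Descent on the length of a path: as long as both ends lie in [F], they are pulled back by [psi]
    and the contracted path has at most half the length. *)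
Lemma Fpow_separates x y : linked X x y -> x <> y ->
  exists n, ~ (Fpow psi n x /\ Fpow psi n y).
Proof.
move=> [p]; have [m] := ubnP (size p); elim: m => // m IH in x y p *.
rewrite ltnS => pm xp yE xy.
have [[Fx Fy]|nF] := pselect (F x /\ F y); last by exists 1; rewrite Fpow1.
have [x' x'E] := psi_surj Fx; have [y' y'E] := psi_surj Fy.
rewrite -x'E -y'E in xp yE xy Fy *.
have [] := (path_contraction p).1 _ xp; first by rewrite yE.
move=> q [xq qE qp _]; rewrite yE in qE; move/psi_inj in qE.
(* The path [p] is nonempty because its ends differ, so halving makes it strictly shorter. *)
have qm : size q < m.
  apply: leq_trans pm; case: p yE qp {xp} => [/= /xy//|a p _]; rewrite /= => qp.
  case: (size q) qp => // k; rewrite doubleS !ltnS => /(leq_trans _); apply.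
  by rewrite -addnn leq_addr.
have [|n nF] := IH _ _ _ qm xq qE; first by move=> x'y'; apply: xy; rewrite x'y'.
by exists n.+1 => -[/Fpow_psi ? /Fpow_psi ?]; exact: nF.
Qed.

Section Preimage.
Hypothesis cell_boundary_other :
  forall C, components X F C -> forall v, exists2 u, boundary X C u & v <> u.
Variables (G C : set V).
Hypotheses (GF : G `<=` F) (C_component : components X (psi @` G) C).

Let GF' : psi @` G `<=` F.
Proof. by move=> _ [x _ <-]; exact: psi_in. Qed.

Let image_psi (A : set V) x : (psi @` A) (psi x) -> A x.
Proof. by move=> [y Ay /psi_inj <-]. Qed.

(** From left to right, an edge [u v] of [X] comes from a cell with [psi u] and [psi v] in its
    boundary; neither is in the image of [G], so both lie in the component that contains this cell.
    From right to left, contraction applies, because the contracted path only visits preimages of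
    vertices of the given one. *)
Lemma preimage_linked x y :
  linked (spanned X (~` G)) x y <->
  linked (spanned X (~` (psi @` G))) (psi x) (psi y).
Proof.
split; last first.
  move=> /linked_spannedP[/psi_inj <-|[Gx [p [xp py pG]]]].
    exact: linked_refl.
  have [|q [xq qy _ qp]] := (path_contraction p).1 _ xp.
    by rewrite py; exact: psi_in.
  rewrite py in qy; move/psi_inj in qy; apply/linked_spannedP; right; split.
    by move=> Gx'; apply: Gx; exists x.
  exists q; split=> // z zq Gz; apply: (pG (psi z)); last by exists z.
  by apply: qp; exact: map_f.
apply: linked_map => u v /and3P[]; rewrite !inE => Gu Gv uv.
have [_ [D FD [Du Dv]]] : psi u <> psi v /\ exists2 D, components X F D &
    boundary X D (psi u) /\ boundary X D (psi v).
  by apply/reducedP; rewrite psi_adj.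
have Gu' : ~ (psi @` G) (psi u) by move/image_psi.
have Gv' : ~ (psi @` G) (psi v) by move/image_psi.
have GE := components_of X Gu'; set E := component_of _ _ _ in GE.
have DE : D `<=` E.
  apply/(components_subP GF' FD GE Du Gu'); exact: component_of_refl.
exact/(components_subP GF' FD GE Dv Gv').
Qed.

(** If a vertex of [C] is outside [F], its cell is contained in [C]. Of two boundary vertices of
    this cell at most one is in the image of [G]; the other one belongs to [C] and to [F]. *)
Lemma preimage_meets : exists x, C (psi x).
Proof.
have [y Cy] := components_neq0 C_component.
have [/psi_surj[x xE]|Fy] := pselect (F y); first by exists x; rewrite xE.
have FD := components_of X Fy; set D := component_of _ _ _ in FD.
have Dy : D y by exact: component_of_refl.
have DC := components_sub GF' FD C_component Dy Cy.
have [u Du _] := cell_boundary_other FD y.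
have [v Dv uv] := cell_boundary_other FD u.
have [w Dw Gw] : exists2 w, boundary X D w & ~ (psi @` G) w.
  have [Gu|] := pselect ((psi @` G) u); last by exists u.
  by exists v => //; exact: not_in_image_boundary GF FD uv Du Dv Gu.
have Cw : C w by apply/(components_subP GF' FD C_component Dw Gw).
by have [x xE] := psi_surj (boundary_components FD Dw); exists x; rewrite xE.
Qed.

Lemma preimage_component : components X G (psi @^-1` C).
Proof.
have [x Cx] := preimage_meets.
exists x; first by move=> Gx; apply: (components_notin C_component Cx); exists x.
by apply/seteqP; split=> y /=;
  rewrite (componentsE C_component Cx) => /preimage_linked.
Qed.

(** If [psi v] borders [C], a neighbour in [C] lies in a cell [D] contained in [C]; a second
    boundary vertex [psi u] of [D] is in [C], and [u] is adjacent to [v]. Conversely, the cell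
    behind an edge [u v] with [psi u] in [C] is contained in [C] and has [psi v] in its boundary. *)
Lemma preimage_boundary : boundary X C = psi @` boundary X (psi @^-1` C).
Proof.
apply/seteqP; split=> [v' Cv'|_ [v Dv <-]].
  have [v Gv vE] := boundary_components C_component Cv'.
  exists v => //; rewrite -vE in Cv'.
  have [Cv [w Cw wv]] := Cv'; split=> //.
  have Fw : ~ F w by move=> Fw; exact: F_independent Fw (psi_in v) wv.
  have FD := components_of X Fw; set D := component_of _ _ _ in FD.
  have Dw : D w by exact: component_of_refl.
  have DC := components_sub GF' FD C_component Dw Cw.
  have Dv := components_boundary FD (psi_in v) Dw wv.
  have [u' Du vu] := cell_boundary_other FD (psi v).
  have [u uE] := psi_surj (boundary_components FD Du); rewrite -uE in Du vu *.
  have Gu : ~ (psi @` G) (psi u).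
    by apply: not_in_image_boundary GF FD vu Dv Du _; exists v.
  exists u; first by apply/(components_subP GF' FD C_component Du Gu).
  rewrite adj_sym -psi_adj; apply/reducedP; split=> //; by exists D.
have Gv := boundary_components preimage_component Dv.
have [Cv [u Cu uv]] := Dv.
have [_ [D FD [Du Dv']]] : psi u <> psi v /\ exists2 D, components X F D &
    boundary X D (psi u) /\ boundary X D (psi v).
  by apply/reducedP; rewrite psi_adj.
split=> //; have [_ [w Dw wv]] := Dv'; exists w => //.
apply: (components_subP GF' FD C_component Du _).1 Dw => //.
exact: components_notin C_component Cu.
Qed.

End Preimage.
End SelfSimilar.

(** * Homogeneously self-similar graphs: uniform data of the cells *)

Section HomogeneouslySelfSimilar.
Variables (V : choiceType) (X : sgraph V) (F : set V) (psi : V -> V) (b : nat).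
Hypotheses (Xconnected : connected_graph X) (Xlocally_finite : locally_finite X)
  (Xinfinite : infinite_graph V)
  (Xhomogeneous : homogeneously_self_similar X F psi)
  (Xinner_degree : constant_inner_degree X F b).

Let Xself_similar := homogeneous_self_similar Xhomogeneous.
Let theta := theta_number X F.
Let delta := delta_number X F.

Lemma has_neighbour v : exists w, X v w.
Proof.
have [y yv] : exists y, y <> v.
  apply: contrapT => nv; apply: Xinfinite; apply: sub_finite_set (finite_set1 v).
  by move=> y _; apply: contrapT => yv; apply: nv; exists y.
have [[|a p] /=] := Xconnected v y; first by move=> _ /esym.
by move=> /andP[va _] _; exists a.
Qed.

Lemma degree_gt0 v : 0 < degree X v.
Proof. exact: num_elements_gt0 (Xlocally_finite v) (has_neighbour v). Qed.

Lemma ex_cell_adj x y : X x y ->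
  exists2 C, components X F C & boundary X C (psi x) /\ boundary X C (psi y).
Proof.
by rewrite -(psi_adj Xself_similar) => /reducedP[].
Qed.

Lemma ex_vertex : exists x : V, True.
Proof.
apply: contrapT => nV; apply: Xinfinite; apply: sub_finite_set (finite_set0 V).
by move=> x _; apply: nV; exists x.
Qed.

Lemma ex_cell : exists C, components X F C.
Proof.
have [x _] := ex_vertex; have [y /ex_cell_adj[C FC _]] := has_neighbour x.
by exists C.
Qed.

(** The cell chosen in [theta_number] and [delta_number], used as the model for all others. *)
Let C0 := xget set0 (components X F).

Let C0_cell : components X F C0.
Proof. by have [C FC] := ex_cell; exact: xgetPex (ex_intro _ C FC). Qed.

Lemma cell_boundary_finite C : components X F C -> finite_set (boundary X C).
Proof.
move=> FC; apply: sub_finite_set (homogeneous_finite Xhomogeneous FC).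
by move=> x; right.
Qed.

Lemma cell_boundary_card C :
  components X F C -> num_elements (boundary X C) = theta.
Proof.
move=> FC.
have [alpha [[_ inj_alpha _] _] <-] := homogeneous_iso Xhomogeneous C0_cell FC.
apply: num_elements_image; first exact: cell_boundary_finite C0_cell.
move=> x y; rewrite !inE => xC yC.
by apply: inj_alpha; rewrite inE; right.
Qed.

Lemma theta_gt1 : 1 < theta.
Proof.
have [x _] := ex_vertex; have [y xy] := has_neighbour x.
have [C FC [Cx Cy]] := ex_cell_adj xy.
rewrite -(cell_boundary_card FC) -subn_gt0.
rewrite -(num_elements_setD1 (cell_boundary_finite FC) Cx).
apply: num_elements_gt0; first by apply: finite_setD; exact: cell_boundary_finite.
exists (psi y); split=> // /= /(psi_inj Xself_similar) yx.
by move: xy; rewrite yx adj_irr.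
Qed.

Lemma cell_boundary_other C : components X F C ->
  forall v, exists2 u, boundary X C u & v <> u.
Proof.
move=> FC v; apply: num_elements_other; first exact: cell_boundary_finite.
by rewrite cell_boundary_card// theta_gt1.
Qed.

(** By (F1) no two boundary vertices are adjacent, so all neighbours of [v] in the closure of the
    cell lie in the cell itself. *)
Lemma cell_inner_degree C v : components X F C -> boundary X C v ->
  num_elements (neighbours X v `&` C) = b.
Proof.
move=> FC Cv; rewrite (Xinner_degree FC Cv) /degree; congr num_elements.
apply/seteqP; split=> w; rewrite /neighbours/=.
  by move=> [vw Cw]; rewrite /spanned/= vw andbT !mem_set//; [left|right].
rewrite /spanned/= => /and3P[_ + vw]; rewrite inE => -[|Cw]; first by [].
by case: (self_similar_F1 Xself_similar (boundary_components FC Cv)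
  (boundary_components FC Cw) vw).
Qed.

(** * Neighbours and degrees counted by cells *)

Definition cells_in (E : set V) v : set (set V) :=
  [set C | [/\ components X F C, C `<=` E & boundary X C v]].

Lemma adj_component v w : F v -> X v w ->
  components X F (component_of X F w) /\ boundary X (component_of X F w) v.
Proof.
move=> Fv vw.
have FC : components X F (component_of X F w).
  by apply: components_of => Fw; exact: (self_similar_F1 Xself_similar) Fv Fw vw.
split=> //; apply: components_boundary FC Fv (component_of_refl X F w) _.
by rewrite adj_sym.
Qed.

Lemma finite_cells_in E v : F v -> finite_set (cells_in E v).
Proof.
move=> Fv.
apply: sub_finite_set (finite_image (component_of X F) (Xlocally_finite v)).
move=> C [FC _ [_ [w Cw wv]]]; exists w; first by rewrite /neighbours/= adj_sym.
by rewrite -(componentsE FC Cw).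
Qed.

(** Each neighbour of [v] lies in exactly one cell, and each cell at [v] receives [b] of them. The
    set [E] is the whole graph for degrees and an n-cell for inner neighbours. *)
Lemma count_neighbours E v : F v ->
  (forall w, X v w -> E w -> component_of X F w `<=` E) ->
  num_elements (neighbours X v `&` E) = num_elements (cells_in E v) * b.
Proof.
move=> Fv vE; apply: (unique_counting (R := fun w C => C w)).
- exact: finite_setIl.
- exact: finite_cells_in.
- move=> w [vw Ew]; have [FC Cv] := adj_component Fv vw.
  exists (component_of X F w); split.
    by split; [split=> //; exact: vE|exact: component_of_refl].
  by move=> D [[FD _ _] Dw]; rewrite (componentsE FD Dw).
- move=> C [FC CE Cv]; rewrite -(cell_inner_degree FC Cv); congr num_elements.
  apply/seteqP; split=> w /=; first by case=> -[].
  by move=> [vw Cw]; split=> //; split=> //; exact: CE.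
Qed.

(** By (F2) a vertex [u] other than [v] shares at most one cell boundary with [v], so the sets of
    [theta - 1] further boundary vertices are disjoint. *)
Lemma count_reduced_neighbours E v : F v ->
  num_elements [set u | v <> u /\ exists2 C, cells_in E v C & boundary X C u] =
  num_elements (cells_in E v) * (theta - 1).
Proof.
move=> Fv; apply: (unique_counting (R := fun u C => boundary X C u)).
- have : finite_set (\bigcup_(C in cells_in E v) boundary X C).
    apply: bigcup_finite (finite_cells_in E Fv) _ => C [FC _ _].
    exact: cell_boundary_finite.
  by apply: sub_finite_set => u [vu [C EC Cu]]; exists C.
- exact: finite_cells_in.
- move=> u [vu [C EC Cu]]; exists C; split=> // D [[FD _ Dv] Du].
  by have [FC _ Cv] := EC; exact: (cell_eq Xself_similar FC FD vu Cv Cu Dv Du).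
- move=> C EC; have [FC _ Cv] := EC; rewrite -(cell_boundary_card FC).
  rewrite -(num_elements_setD1 (cell_boundary_finite FC) Cv); congr num_elements.
  apply/seteqP; split=> u /=.
    by move=> [[vu _] Cu]; split=> // uv; apply: vu.
  move=> [Cu uv]; split=> //; split; first by move=> vu; exact: uv.
  by exists C.
Qed.

Lemma degree_cells v : F v -> degree X v = num_elements (cells_in setT v) * b.
Proof. by move=> Fv; rewrite -count_neighbours// setIT. Qed.

Lemma degree_reduced_cells v : F v ->
  degree (reduced X F) v = num_elements (cells_in setT v) * (theta - 1).
Proof.
move=> Fv; rewrite -count_reduced_neighbours//; congr num_elements.
apply/seteqP; split=> u.
  move=> /reducedP[vu [C FC [Cv Cu]]]; split=> //.
  by exists C.
move=> [vu [C [FC _ Cv] Cu]]; apply/reducedP; split=> //.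
by exists C.
Qed.

Lemma degree_reduced_psi v : degree (reduced X F) (psi v) = degree X v.
Proof.
rewrite /degree (neighbours_reduced Xself_similar).
apply: num_elements_image; first exact: Xlocally_finite.
by move=> x y _ _; exact: (psi_inj Xself_similar).
Qed.

Lemma degree_psi v : degree X (psi v) * (theta - 1) = degree X v * b.
Proof.
have Fv := psi_in Xself_similar v.
by rewrite -(degree_reduced_psi v) degree_reduced_cells// degree_cells// mulnAC.
Qed.

Lemma num_cells_gt0 v : F v -> 0 < num_elements (cells_in setT v).
Proof.
by move=> Fv; have := degree_gt0 v; rewrite degree_cells// muln_gt0 => /andP[].
Qed.

Lemma b_gt0 : 0 < b.
Proof.
have [v _] := ex_vertex; have := degree_gt0 (psi v).
by rewrite (degree_cells (psi_in Xself_similar v)) muln_gt0 => /andP[].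
Qed.

Lemma degree_reduced_eqP :
  (forall v, F v -> degree X v = degree (reduced X F) v) <-> b = theta - 1.
Proof.
split=> [dE|bE v Fv]; last by rewrite degree_cells// degree_reduced_cells// bE.
have [v _] := ex_vertex; have Fv := psi_in Xself_similar v.
apply/eqP; rewrite -(eqn_pmul2l (num_cells_gt0 Fv)); apply/eqP.
by rewrite -degree_cells// -degree_reduced_cells// dE.
Qed.

(** The edges are grouped by their outer endpoint, the second component of the pair. *)
Lemma edge_boundary_card E k : finite_set (boundary X E) ->
  (forall v, boundary X E v -> num_elements (neighbours X v `&` E) = k) ->
  finite_set (edge_boundary X E) /\
  num_elements (edge_boundary X E) = num_elements (boundary X E) * k.
Proof.
move=> fE Ek; have fdE : finite_set (edge_boundary X E).
  have fN : finite_set (\bigcup_(v in boundary X E) neighbours X v).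
    exact: bigcup_finite.
  apply: sub_finite_set (finite_setX fN fE) => -[w v] [/= Ew Ev wv].
  have Bv : boundary X E v by split=> //; exists w.
  by split=> //; exists v => //; rewrite /neighbours/= adj_sym.
split=> //; apply: (unique_counting (R := fun wv v => wv.2 = v)) => //.
  move=> [w v] [/= Ew Ev wv]; exists v; split; last by move=> u [].
  by split=> //; split=> //; exists w.
move=> v Bv; rewrite -(Ek v Bv).
rewrite -(@num_elements_image _ _ (fun w => (w, v)) (neighbours X v `&` E)).
- congr num_elements; apply/seteqP; split=> -[w u] /=.
    by move=> [[/= Ew _ wu] uv]; exists w; rewrite -?uv//; split=> //;
      rewrite /neighbours/= adj_sym.
  move=> [x [vx Ex] [<- <-]]; split=> //; split=> //=; first by case: Bv.
  by rewrite adj_sym.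
- exact: finite_setIl.
- by move=> x y _ _ [].
Qed.

Lemma deltaE : delta = theta * b.
Proof.
rewrite -(cell_boundary_card C0_cell); apply: (edge_boundary_card _ _).2.
  exact: cell_boundary_finite.
by move=> v; exact: cell_inner_degree.
Qed.

Lemma delta_eqP : delta = theta * (theta - 1) <-> b = theta - 1.
Proof.
rewrite deltaE; split=> [/eqP|->//].
by rewrite eqn_pmul2l ?(ltn_trans _ theta_gt1)// => /eqP.
Qed.

(** * Boundaries of n-cells *)

Lemma count_ncell_neighbours n C v : ncells X psi n.+1 C -> boundary X C v ->
  num_elements (neighbours X v `&` C) = num_elements (cells_in C v) * b.
Proof.
move=> nC Cv; have Fv := Fpow_inF Xself_similar (boundary_components nC Cv).
(* As [Fpow psi n.+1] lies in [F], a cell that meets [C] is contained in [C]. *)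
apply: count_neighbours => // w vw Cw; have [FD _] := adj_component Fv vw.
have nF := Fpow_inF Xself_similar (n := n).
by apply: components_sub nF FD nC _ Cw; exact: component_of_refl.
Qed.

(* Both sides count the neighbours of [psi v] in [X_F] that belong to [C]. *)
Lemma count_preimage_neighbours n C v :
  ncells X psi n.+2 C -> boundary X C (psi v) ->
  num_elements (cells_in C (psi v)) * (theta - 1) =
  num_elements (neighbours X v `&` psi @^-1` C).
Proof.
move=> nC Cv; have Fv := psi_in Xself_similar v.
have GF := Fpow_inF Xself_similar (n := n).
have GF' := Fpow_inF Xself_similar (n := n.+1).
rewrite -count_reduced_neighbours// -[RHS](@num_elements_image _ _ psi).
- congr num_elements; apply/seteqP; split=> u.
    move=> [vu [D [FD DC Dv] Du]]; have := boundary_components FD Du.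
    move=> /(psi_surj Xself_similar)[u' uE]; rewrite -uE in vu Du *.
    exists u' => //; split.
      rewrite /neighbours/= -(psi_adj Xself_similar); apply/reducedP; split=> //.
      by exists D.
    (* Since [psi v] is in [Fpow psi n.+2], the other boundary vertex [psi u'] of [D] is not, so it
       lies in [C] along with [D]. *)
    apply/(components_subP GF' FD nC Du) => //.
    have := boundary_components nC Cv; rewrite FpowS => nv.
    exact: (not_in_image_boundary Xself_similar GF FD vu Dv Du nv).
  move=> [u' [vu Cu] <-].
  have [vu' [D FD [Dv Du]]] : psi v <> psi u' /\ exists2 D, components X F D &
      boundary X D (psi v) /\ boundary X D (psi u').
    by apply/reducedP; rewrite (psi_adj Xself_similar).
  split=> //; exists D => //; split=> //.
  apply/(components_subP GF' FD nC Du) => //; exact: components_notin nC Cu.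
- exact: finite_setIl.
- by move=> x y _ _; exact: (psi_inj Xself_similar).
Qed.

Lemma ncell_preimage n C : ncells X psi n.+2 C ->
  ncells X psi n.+1 (psi @^-1` C) /\
  boundary X C = psi @` boundary X (psi @^-1` C).
Proof.
rewrite /ncells FpowS => nC; have GF := Fpow_inF Xself_similar (n := n).
have other := cell_boundary_other.
split; first exact: (preimage_component Xself_similar other GF nC).
exact: (preimage_boundary Xself_similar other GF nC).
Qed.

Lemma ncell_boundary_card n C : ncells X psi n.+1 C ->
  finite_set (boundary X C) /\ num_elements (boundary X C) = theta.
Proof.
elim: n C => [C|n IH C /ncell_preimage[/IH[fD Dtheta] ->]].
  rewrite /ncells (Fpow1 Xself_similar) => FC.
  by split; [exact: cell_boundary_finite|exact: cell_boundary_card].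
split; first exact: finite_image.
by rewrite num_elements_image// => x y _ _; exact: (psi_inj Xself_similar).
Qed.

Lemma cells_in_cell C v : components X F C -> boundary X C v ->
  cells_in C v = [set C].
Proof.
move=> FC Cv; apply/seteqP; split=> D; last by move=> ->; split.
move=> [FD DC _]; have [x Dx] := components_neq0 FD.
exact: components_eq FD FC Dx (DC _ Dx).
Qed.

(** Induction along preimages: if one cell of the preimage borders [v], then [v] has [b] neighbours
    there, so the number of cells of [C] at [psi v] times [theta - 1] is [b]. *)
Lemma ncell_num_cells n C v : b = theta - 1 -> ncells X psi n.+1 C ->
  boundary X C v -> num_elements (cells_in C v) = 1.
Proof.
move=> bE; elim: n C v => [C v|n IH C v nC].
  rewrite /ncells (Fpow1 Xself_similar) => FC Cv.
  by rewrite cells_in_cell// num_elements1.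
have [nD ->] := ncell_preimage nC => -[{}v Dv <-].
have Cv : boundary X C (psi v) by rewrite (ncell_preimage nC).2; exists v.
apply/eqP; rewrite -(eqn_pmul2r b_gt0) [X in _ * X]bE.
rewrite (count_preimage_neighbours nC Cv) (count_ncell_neighbours nD Dv).
by rewrite (IH _ _ nD Dv).
Qed.

Lemma ncell2_num_cells C v : ncells X psi 2 C -> boundary X C v ->
  num_elements (cells_in C v) * (theta - 1) = b.
Proof.
move=> nC; have [nD ->] := ncell_preimage nC => -[{}v Dv <-].
have Cv : boundary X C (psi v) by rewrite (ncell_preimage nC).2; exists v.
rewrite (count_preimage_neighbours nC Cv); apply: cell_inner_degree => //.
by move: nD; rewrite /ncells (Fpow1 Xself_similar).
Qed.

Lemma ex_ncell n : exists C, ncells X psi n.+1 C.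
Proof.
have [x C0x] := components_neq0 C0_cell.
exists (component_of X (Fpow psi n.+1) x); apply: components_of.
by move/(Fpow_inF Xself_similar); exact: components_notin C0_cell C0x.
Qed.

Lemma ncell_boundary_neq0 n C : ncells X psi n.+1 C -> boundary X C !=set0.
Proof.
move=> nC; have [fB Btheta] := ncell_boundary_card nC; have [x _] := ex_vertex.
have [|v Cv _] := num_elements_other x fB; first by rewrite Btheta theta_gt1.
by exists v.
Qed.

Lemma ncell_edge_boundary n C : b = theta - 1 -> ncells X psi n.+1 C ->
  (edge_boundary X C #= `I_delta)%card.
Proof.
move=> bE nC; have [fB Btheta] := ncell_boundary_card nC.
have [|fE EE] := edge_boundary_card (k := b) fB.
  move=> v Bv; rewrite (count_ncell_neighbours nC Bv) (ncell_num_cells bE nC Bv).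
  exact: mul1n.
by apply/(card_eq_num_elements _ fE); rewrite EE Btheta deltaE.
Qed.

(** The number [m] of cells of [C] at a boundary vertex is the same for all of them, so the edge
    boundary has [theta * (m * b)] elements. Comparison with [theta * b] forces [m = 1]. *)
Lemma edge_boundary_ncell2 C : ncells X psi 2 C ->
  (edge_boundary X C #= `I_delta)%card -> b = theta - 1.
Proof.
move=> nC Cdelta; have [v Cv] := ncell_boundary_neq0 nC.
have [fB Btheta] := ncell_boundary_card nC.
have theta1 : 0 < theta - 1 by rewrite subn_gt0 theta_gt1.
have mE u : boundary X C u ->
    num_elements (cells_in C u) = num_elements (cells_in C v).
  move=> Cu; apply/eqP; rewrite -(eqn_pmul2r theta1); apply/eqP.
  by rewrite !ncell2_num_cells.
have [|fE] := edge_boundary_card (k := num_elements (cells_in C v) * b) fB.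
  by move=> u Cu; rewrite (count_ncell_neighbours nC Cu) mE.
move/(card_eq_num_elements _ fE): Cdelta => ->; rewrite Btheta deltaE => /eqP.
rewrite eqn_pmul2l ?(ltn_trans _ theta_gt1)// -{1}[b]mul1n.
rewrite eqn_pmul2r ?b_gt0// => /eqP m1.
by rewrite -(ncell2_num_cells nC Cv) -m1 mul1n.
Qed.

(** * Bounded geometry *)

Lemma degree_le_cell v : ~ F v -> degree X v <= num_elements (graph_closure X C0).
Proof.
move=> Fv; have FC := components_of X Fv; set C := component_of _ _ _ in FC.
have Cv : C v by exact: component_of_refl.
have [alpha [[_ _ surj_alpha] _] _] := homogeneous_iso Xhomogeneous C0_cell FC.
have fC0 := homogeneous_finite Xhomogeneous C0_cell.
(* The closure of the cell of [v] contains all neighbours of [v] and is covered by the image of the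
   closure of [C0]. *)
apply: leq_trans (_ : num_elements (alpha @` graph_closure X C0) <= _).
  apply: le_num_elements; first exact: finite_image.
  move=> w vw; apply: surj_alpha; have [Cw|nCw] := pselect (C w); first by left.
  by right; split=> //; exists v.
by rewrite /num_elements fset_set_image//; exact: leq_imfset_card.
Qed.

Lemma bounded_geometryP : bounded_geometry X <-> b = theta - 1.
Proof.
have theta1 : 0 < theta - 1 by rewrite subn_gt0 theta_gt1.
split=> [[M Xle]|bE].
  have [v _] := ex_vertex; have [b_lt|b_gt|//] := ltngtP b (theta - 1).
    have lt_psi u : degree X (psi u) < degree X u.
      by rewrite -(ltn_pmul2r theta1) degree_psi ltn_pmul2l ?degree_gt0//.
    have /(_ (degree X v).+1) : forall n,
        n + degree X (iter n psi v) <= degree X v.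
      elim=> // n; apply: leq_trans.
      by rewrite addSn -addnS leq_add2l; exact: lt_psi.
    by move/(leq_trans (leq_addr _ _)); rewrite ltnn.
  have lt_psi u : degree X u < degree X (psi u).
    by rewrite -(ltn_pmul2r theta1) degree_psi ltn_pmul2l ?degree_gt0//.
  have /(_ M.+1) : forall n, n <= degree X (iter n psi v).
    by elim=> // n IH; exact: leq_ltn_trans IH (lt_psi _).
  by move/leq_trans => /(_ _ (Xle _)); rewrite ltnn.
have degE u : degree X (psi u) = degree X u.
  by apply/eqP; rewrite -(eqn_pmul2r theta1) degree_psi bE.
pose M := num_elements (graph_closure X C0).
(* A vertex outside [Fpow psi n] is pulled back by [psi], with its degree unchanged, until it lies
   outside [F]. *)
have Xle n v : ~ Fpow psi n v -> degree X v <= M.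
  elim: n v => [v|n IH v nF]; first by case; exists v.
  have [/(psi_surj Xself_similar)[u uE]|] := pselect (F v);
    last exact: degree_le_cell.
  rewrite -uE degE; apply: IH => nu; apply: nF; rewrite FpowS.
  by exists u.
(* At most one vertex [o] lies in every [Fpow psi n], since [Fpow_separates] excludes a second one;
   its degree enters the bound separately. *)
have [[o oF]|no] := pselect (exists o, forall n, Fpow psi n o).
  exists (maxn M (degree X o)) => v; rewrite leq_max.
  have [->|/eqP vo] := eqVneq v o; first by rewrite leqnn orbT.
  have [n nF] := Fpow_separates Xself_similar (Xconnected v o) vo.
  by rewrite (Xle n)// => vF; apply: nF.
exists M => v; have /existsNP[n nF] : ~ forall n, Fpow psi n v.
  by move=> vF; apply: no; exists v.
exact: Xle nF.
Qed.

End HomogeneouslySelfSimilar.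

Theorem theorem3 (V : choiceType) (X : sgraph V) (F : set V) (psi : V -> V)
    (b : nat)
    (Xconnected : connected_graph X)
    (Xlocally_finite : locally_finite X)
    (Xinfinite : infinite_graph V)
    (Xhomogeneous : homogeneously_self_similar X F psi)
    (Xinner_degree : constant_inner_degree X F b) :
  [<-> bounded_geometry X;
       b = theta_number X F - 1;
       locally_finite X /\
         (forall v, F v -> degree X v = degree (reduced X F) v);
       forall n, 0 < n -> forall Cn, ncells X psi n Cn ->
         (edge_boundary X Cn #= `I_(delta_number X F))%card;
       forall n, 0 < n -> forall Cn, ncells X psi n Cn ->
         forall v, boundary X Cn v ->
           exists! C, [/\ components X F C, C `<=` Cn & boundary X C v];
       delta_number X F = theta_number X F * (theta_number X F - 1)].

Proof.
have := bounded_geometryP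
  Xconnected Xlocally_finite Xinfinite Xhomogeneous Xinner_degree.
have := degree_reduced_eqP
  Xconnected Xlocally_finite Xinfinite Xhomogeneous Xinner_degree.
have := delta_eqP
  Xconnected Xlocally_finite Xinfinite Xhomogeneous Xinner_degree.
have := @ncell_edge_boundary _ _ _ _ _
  Xconnected Xlocally_finite Xinfinite Xhomogeneous Xinner_degree.
have := @edge_boundary_ncell2 _ _ _ _ _
  Xconnected Xlocally_finite Xinfinite Xhomogeneous Xinner_degree.
have := @ncell_num_cells _ _ _ _ _
  Xconnected Xlocally_finite Xinfinite Xhomogeneous Xinner_degree.
have := @ncell2_num_cells _ _ _ _ _
  Xconnected Xlocally_finite Xinfinite Xhomogeneous Xinner_degree.
(* For 1-cells, (iv) and (v) hold whatever [b] is; a 2-cell is the first case that determines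
   [b]. *)
have [C2 nC2] := ex_ncell Xconnected Xinfinite Xhomogeneous 1.
have [v2 Cv2] := ncell_boundary_neq0 Xconnected Xinfinite Xhomogeneous nC2.
move=> num2 num1 edge2 edge deltaP degP geoP; tfae.
- by move/geoP.
- by move/degP.
- by move=> [_ /degP bE] [//|n] _ C; exact: edge.
- move=> /(_ 2 isT _ nC2)/(edge2 _ nC2) bE [//|n] _ C nC v Cv.
  have Fv := Fpow_inF (homogeneous_self_similar Xhomogeneous)
    (boundary_components nC Cv).
  have [D DE] := num_elements_eq1 (finite_cells_in Xlocally_finite C Fv)
    (num1 _ _ _ bE nC Cv).
  exists D; split; first by have : cells_in X F C v D by rewrite DE.
  by move=> E CE; have : cells_in X F C v E by []; rewrite DE.
- move=> /(_ 2 isT _ nC2 _ Cv2)[D [DC Duniq]]; apply/deltaP.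
  rewrite -(num2 _ _ nC2 Cv2).
  have -> : cells_in X F C2 v2 = [set D].
    by apply/seteqP; split=> [E /Duniq->|_ ->].
  by rewrite num_elements1 mul1n.
- by move=> /deltaP/geoP.
Qed.
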